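(* Let $2\le r<m\le n$ and $k\ge1$. Then $\mathcal Z^{m,n}_{r,k}$ has at least $1+\lfloor k/2\rfloor$ irreducible components.
   Context: Let $F$ be an algebraically closed field. For integers $1\le r\le m\le n$ and $k\ge 1$, let $S=F[x^{(l)}_{i,j}:1\le i\le m,\ 1\le j\le n,\ 0\le l\le k-1]$, the coordinate ring of $\mathbf A^{mnk}_F$, and let $X(t)$ be the $m\times n$ matrix over $S[t]/(t^k)$ with $(i,j)$ entry $x_{i,j}(t)=\sum_{l=0}^{k-1}x^{(l)}_{i,j}t^l$. $\mathcal I^{m,n}_{r,k}\subseteq S$ is the ideal generated by the coefficients of $t^l$, $0\le l\le k-1$, of all $r\times r$ minors of $X(t)$, and $\mathcal Z^{m,n}_{r,k}\subseteq\mathbf A^{mnk}_F$ is its zero set. *)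

(* Defs.v *)
From HB Require Import structures.
From mathcomp Require Import all_boot all_order all_algebra.
From mathcomp Require Import mpoly.
Set Implicit Arguments. Unset Strict Implicit. Unset Printing Implicit Defensive.
Import GRing.Theory.
Local Open Scope ring_scope.

(* A point of A^{#|T|}_F is a function T -> F; the coordinate ring is
   {mpoly F[#|T|]}, the variable 'X_i corresponding to the coordinate enum_val i. *)

Definition coords (F : closedFieldType) (T : finType) (x : T -> F) : 'I_#|T| -> F :=
  fun i => x (enum_val i).

Definition zariski_closed (F : closedFieldType) (T : finType) (S : (T -> F) -> Prop) :=
  exists P : {mpoly F[#|T|]} -> Prop,
    forall x, S x <-> (forall p, P p -> p.@[coords x] = 0).

Definition subsetP (F : Type) (T : Type) (A B : (T -> F) -> Prop) := forall x, A x -> B x.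

Definition zariski_irreducible (F : closedFieldType) (T : finType) (S : (T -> F) -> Prop) :=
  [/\ zariski_closed S,
      exists x, S x &
      forall A B : (T -> F) -> Prop, zariski_closed A -> zariski_closed B ->
        (forall x, S x -> A x \/ B x) -> subsetP S A \/ subsetP S B].

Definition irreducible_component (F : closedFieldType) (T : finType)
    (S Z : (T -> F) -> Prop) :=
  [/\ zariski_irreducible S, subsetP S Z &
      forall S', zariski_irreducible S' -> subsetP S S' -> subsetP S' Z -> subsetP S' S].

Definition jet_index (m n k : nat) : finType := ('I_m * 'I_n * 'I_k)%type.

Definition jet_matrix (F : closedFieldType) (m n k : nat) (x : jet_index m n k -> F)
  : 'M[{poly F}]_(m, n) :=
  \matrix_(i < m, j < n) \sum_(l < k) x (i, j, l) *: 'X^l.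

Definition jet_minor (F : closedFieldType) (m n k r : nat) (x : jet_index m n k -> F)
  (f : 'I_r -> 'I_m) (g : 'I_r -> 'I_n) : {poly F} :=
  \det (\matrix_(a < r, b < r) jet_matrix x (f a) (g b)).

(* Z^{m,n}_{r,k}: common zeros of the coefficients of t^l (0 <= l <= k-1) of all r x r minors
   of X(t).  Computing the minor in F[t] and then taking coefficients l < k is the same as
   computing it in F[t]/(t^k). *)
Definition jetZ (F : closedFieldType) (m n r k : nat) : (jet_index m n k -> F) -> Prop :=
  fun x => forall (f : 'I_r -> 'I_m) (g : 'I_r -> 'I_n),
    {homo f : a b / (a < b)%N >-> (a < b)%N} ->
    {homo g : a b / (a < b)%N >-> (a < b)%N} ->
    forall l : nat, (l < k)%N -> (jet_minor x f g)`_l = 0.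

(* Main.v *)
Require Import Defs.
From HB Require Import structures.
From mathcomp Require Import all_boot all_order all_algebra.
From mathcomp Require Import mpoly.
From mathcomp Require boolp classical_sets.
From mathcomp Require Import zify ring.

(* For i <= k/2 the diagonal jet p_i = diag(1, ..., 1, t^i, t^(k-i), ..., t^(k-i)), with r - 2
   ones, lies in Z, hence (by Zorn) in some irreducible component.  No irreducible subset of Z
   contains both p_i and p_j for i < j.  Indeed let d and D be the leading principal minors of
   sizes r - 1 and r + 1.  By Jacobi's identity d D is a 2 x 2 minor of the adjugate of the
   (r+1) x (r+1) block, whose entries are r x r minors, so t^(2k) divides d D on Z.  As
   i + (2k - j) < 2k, at every point of Z the coefficient of t^i in d or that of t^(2k-j)
   in D vanishes; but the first is 1 at p_i and the second is 1 at p_j. *)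

Set Implicit Arguments. Unset Strict Implicit. Unset Printing Implicit Defensive.
Import GRing.Theory.
Local Open Scope ring_scope.

(** * Zariski closures and existence of irreducible components *)

Section Zariski.
Variables (F : closedFieldType) (T : finType).
Implicit Types (S Z : (T -> F) -> Prop) (x y : T -> F).

Definition zariski_closure S x :=
  forall p : {mpoly F[#|T|]},
    (forall y, S y -> p.@[coords y] = 0) -> p.@[coords x] = 0.

Lemma zariski_closed_closure S : zariski_closed (zariski_closure S).
Proof.
by exists (fun p => forall y, S y -> p.@[coords y] = 0).
Qed.

Lemma sub_zariski_closure S : Defs.subsetP S (zariski_closure S).
Proof. by move=> x Sx p; apply. Qed.

Lemma zariski_closure_sub S Z :
  zariski_closed Z -> Defs.subsetP S Z -> Defs.subsetP (zariski_closure S) Z.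
Proof.
move=> [P ZP] SZ x xS; apply/ZP => p Pp; apply: xS => y /SZ /ZP; exact.
Qed.

Lemma zariski_closed_zero (p : {mpoly F[#|T|]}) :
  zariski_closed (fun x => p.@[coords x] = 0).
Proof.
by exists (eq p) => x; split=> [px q <-//|]; apply.
Qed.

Lemma zariski_irreducible_point x : zariski_irreducible (eq x).
Proof.
split; last first.
- move=> A B _ _ /(_ x erefl)[xA | xB]; [left | right]; by move=> y <-.
- by exists x.
exists (fun p => p.@[coords x] = 0) => y; split=> [<-//|] xy.
apply/boolp.funext => t; symmetry.
have /= := xy ('X_(enum_rank t) - (x t)%:MP_[#|T|]).
rewrite !mevalB !mevalXU !mevalC /coords enum_rankK subrr => /(_ erefl) /eqP.
by rewrite subr_eq0 => /eqP.
Qed.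

(** Zorn's lemma for the irreducible subsets of [Z] through [x]: the empty chain is bounded by the
    point [x], any other by the closure of its union. *)
Lemma irreducible_component_exists Z x :
  zariski_closed Z -> Z x ->
  exists2 C, irreducible_component C Z & C x.
Proof.
move=> cZ Zx.
pose good S := [/\ zariski_irreducible S, Defs.subsetP S Z & S x].
pose le (S1 S2 : {S | good S}) := boolp.asbool (Defs.subsetP (sval S1) (sval S2)).
have leP (S1 S2 : {S | good S}) : reflect (Defs.subsetP (sval S1) (sval S2)) (le S1 S2).
  exact: boolp.asboolP.
have gx : good (eq x) by split=> // [|y <-//]; apply: zariski_irreducible_point.
have [||A totA|[C [iC CZ Cx]] Cmax] := @classical_sets.ZL_preorder _ (exist _ _ gx) le.
- by move=> S; apply/leP.
- by move=> S1 S2 S3 /leP S12 /leP S23; apply/leP => y /S12 /S23.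
- have [[S0 AS0]|A0] := boolp.EM (exists K, A K); last first.
    by exists (exist _ _ gx) => S AS; case: A0; exists S.
  pose U y := exists2 K, A K & sval K y.
  have gU : good (zariski_closure U).
    split; last first.
    + by apply: sub_zariski_closure; exists S0 => //; case: (svalP S0).
    + apply: zariski_closure_sub => // y [S _ Sy].
      by have [_ SZ _] := svalP S; apply: SZ.
    split; first exact: zariski_closed_closure.
    + exists x; apply: sub_zariski_closure.
      by exists S0 => //; case: (svalP S0).
    move=> B1 B2 cB1 cB2 sU.
    have sA (S : {S | good S}) : A S -> Defs.subsetP (sval S) B1 \/ Defs.subsetP (sval S) B2.
      move=> AS; have [[_ _ irrS] _ _] := svalP S.
      apply: irrS => // y Sy; apply: sU; apply: sub_zariski_closure.
      by exists S.
    have [allB1|] := boolp.EM (forall K, A K -> Defs.subsetP (sval K) B1).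
      by left; apply: zariski_closure_sub => // y [S /allB1]; apply.
    (* A member [S1] not inside [B1] forces into [B2] every member containing it, and the smaller
       ones follow. *)
    move=> /boolp.existsNP[S1 /boolp.not_implyP[AS1 nS1]].
    right; apply: zariski_closure_sub => // y [S AS Sy].
    have S1B2 : Defs.subsetP (sval S1) B2 by case: (sA _ AS1).
    have [/leP SS1|/leP S1S] := totA _ _ AS AS1; first exact/S1B2/SS1.
    case: (sA _ AS) => [SB1|]; last exact.
    by case: nS1 => z /S1S /SB1.
  exists (exist _ _ gU) => S AS; apply/leP => y Sy.
  by apply: sub_zariski_closure; exists S.
exists C => //; split=> // S iS CS SZ.
(* Maximality is known only among sets through [x], but [S] contains [C] and hence [x]. *)
have gS : good S by split=> //; apply: CS.
by apply/(leP (exist _ S gS) (exist good C (And3 iC CZ Cx)))/Cmax/leP.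
Qed.

End Zariski.

(** * Jacobi's identity for a minor of the adjugate *)

Section Jacobi.
Variables (R : idomainType) (n : nat) (M : 'M[R]_(n + 2)).

(* Take determinants in M * [[1, (adj M)_ur], [0, (adj M)_dr]] = [[M_ul, 0], [M_dl, det M]]. *)
Lemma det_drsubmx_adj : \det M != 0 ->
  \det (drsubmx (\adj M)) = \det M * \det (ulsubmx M).
Proof.
(* The scalar block [\det M] has size 2 and contributes its square, so one factor has to be
   cancelled. *)
move=> M0; apply: (mulfI M0).
have := det_mulmx M (block_mx 1%:M (ursubmx (\adj M)) 0 (drsubmx (\adj M))).
rewrite det_ublock det1 mul1r => <-.
rewrite -[X in X *m _]submxK mulmx_block !mulmx1 !mulmx0 !addr0.
have := mul_mx_adj M.
rewrite -[X in X *m _]submxK -[X in _ *m X]submxK mulmx_block scalar_mx_block.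
move=> /eq_block_mx[_ -> _ ->].
by rewrite det_lblock det_scalar; ring.
Qed.

End Jacobi.

(** * Orders of vanishing at t = 0 *)

Section Order.
Variable R : idomainType.
Implicit Types p q : {poly R}.

Lemma coef_lt_dvdXn n p : (forall i, (i < n)%N -> p`_i = 0) ->
  exists q, p = q * 'X^n.
Proof.
move=> p0; exists (drop_poly n p).
rewrite -[LHS](poly_take_drop n) (_ : take_poly n p = 0) ?add0r//.
by apply/polyP => i; rewrite coef_take_poly coef0; case: ifP => // /p0.
Qed.

(** Over a domain the lowest nonzero coefficients of [p] and [q] multiply to that of [p * q]. *)
Lemma coef_mul_min p q i j : p`_i != 0 -> q`_j != 0 ->
  exists2 l, (l <= i + j)%N & (p * q)`_l != 0.
Proof.
move=> pi qj.
case: (ex_minnP (ex_intro (fun i => p`_i != 0) i pi)) => a pa amin.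
case: (ex_minnP (ex_intro (fun i => q`_i != 0) j qj)) => b qb bmin.
exists (a + b)%N; first by rewrite leq_add ?amin ?bmin.
have la : (a < (a + b).+1)%N by rewrite ltnS leq_addr.
rewrite coefM (bigD1 (Ordinal la)) //= addKn big1 ?addr0 ?mulf_neq0//.
move=> [c /= lc]; rewrite -val_eqE /= => ca.
have [ltca|ltac] := ltnP c a.
  suff -> : p`_c = 0 by rewrite mul0r.
  by apply/eqP; apply: contraTT ltca => /amin; rewrite leqNgt.
suff -> : q`_(a + b - c) = 0 by rewrite mulr0.
apply/eqP; apply: contraTT isT => /bmin; lia.
Qed.

End Order.

(** * Minors on the jet scheme and the diagonal jets *)

Section Jets.
Variables (F : closedFieldType) (m n k : nat).
Implicit Type x : jet_index m n k -> F.

(** Take the minor of the generic jet matrix; evaluation is a ring morphism and commutes with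
    determinants. *)
Lemma jet_minor_mpoly r (f : 'I_r -> 'I_m) (g : 'I_r -> 'I_n) l :
  exists p : {mpoly F[#|jet_index m n k|]},
    forall x, p.@[coords x] = (jet_minor x f g)`_l.
Proof.
pose X : 'M[{poly {mpoly F[#|jet_index m n k|]}}]_(m, n) :=
  \matrix_(i, j) \sum_(l < k) 'X_(enum_rank (i, j, l)) *: 'X^l.
exists (\det (\matrix_(a < r, b < r) X (f a) (g b)))`_l => x.
rewrite -[LHS]coef_map -det_map_mx /jet_minor; congr ((polyseq (\det _))`_l).
apply/matrixP => a b; rewrite !mxE raddf_sum; apply: eq_bigr => i _ /=.
by rewrite map_polyZ map_polyXn /= [meval _ _]mevalXU /coords enum_rankK.
Qed.

Lemma zariski_closed_jetZ r : zariski_closed (@jetZ F m n r k).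
Proof.
exists (fun p => forall x, @jetZ F m n r k x -> p.@[coords x] = 0) => x.
split=> [Zx p|zx f g fh gh l lk]; first exact.
have [p pE] := jet_minor_mpoly f g l.
by rewrite -pE; apply: zx => y Zy; rewrite pE; apply: Zy.
Qed.

(* The entries of the adjugate are minors of size s + 2, hence divisible by t^k, so that
   its lower right 2 x 2 minor is divisible by t^(2k). *)
Lemma jetZ_minor_mul s x (f : 'I_(s.+1 + 2) -> 'I_m) (g : 'I_(s.+1 + 2) -> 'I_n) :
  {homo f : a b / (a < b)%N >-> (a < b)%N} ->
  {homo g : a b / (a < b)%N >-> (a < b)%N} ->
  @jetZ F m n (s + 2) k x -> jet_minor x f g != 0 ->
  forall l, (l < k + k)%N ->
  (jet_minor x f g * jet_minor x (f \o lshift 2) (g \o lshift 2))`_l = 0.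
Proof.
move=> fh gh Zx; rewrite /jet_minor; set M := \matrix_(a, b) _ => M0 l lk.
have -> : \matrix_(a, b) jet_matrix x ((f \o lshift 2) a) ((g \o lshift 2) b)
    = ulsubmx M.
  by apply/matrixP => a b; rewrite !mxE.
(* Deleting one index keeps the selection increasing, so cofactors are, up to sign, minors that
   [jetZ] controls. *)
have lift_homo N (h : 'I_(s.+1 + 2) -> 'I_N) i :
    {homo h : a b / (a < b)%N >-> (a < b)%N} ->
    {homo h \o lift i : a b / (a < b)%N >-> (a < b)%N}.
  by move=> hh a b ab; apply: hh; rewrite /= ltnNge leq_bump2 -ltnNge.
have adjX i j : exists q, (\adj M) i j = q * 'X^k.
  rewrite mxE /cofactor.
  have [q qE] := coef_lt_dvdXn (Zx _ _ (lift_homo _ _ j fh) (lift_homo _ _ i gh)).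
  exists ((-1) ^+ (j + i) * q); rewrite -mulrA -qE; congr (_ * \det _).
  by apply/matrixP => a b; rewrite !mxE.
have [Q QE] : exists Q, drsubmx (\adj M) = 'X^k *: Q.
  have /boolp.choice[q qE] : forall ij : 'I_2 * 'I_2,
      exists q, drsubmx (\adj M) ij.1 ij.2 = q * 'X^k.
    by move=> [i j]; rewrite mxE mxE; apply: adjX.
  exists (\matrix_(i, j) q (i, j)); apply/matrixP => i j.
  by rewrite (qE (i, j)) 2!mxE mulrC.
by rewrite -det_drsubmx_adj // QE detZ mulrC -exprM muln2 -addnn coefMXn lk.
Qed.

Lemma jetZ_minor_coef0 s x (f : 'I_(s.+1 + 2) -> 'I_m) (g : 'I_(s.+1 + 2) -> 'I_n) i j :
  {homo f : a b / (a < b)%N >-> (a < b)%N} ->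
  {homo g : a b / (a < b)%N >-> (a < b)%N} ->
  @jetZ F m n (s + 2) k x -> (i + j < k + k)%N ->
  (jet_minor x f g)`_i = 0 \/
  (jet_minor x (f \o lshift 2) (g \o lshift 2))`_j = 0.
Proof.
move=> fh gh Zx ijk; have [|fi] := eqVneq (jet_minor x f g)`_i 0; first by left.
right; apply/eqP; apply: contraTT isT => gj.
have [l lij] := coef_mul_min fi gj.
rewrite jetZ_minor_mul ?eqxx ?(leq_ltn_trans lij)//.
by apply: contraNneq fi => ->; rewrite coef0.
Qed.

(* The jet diag(1, ..., 1, t^i, t^(k - i), ..., t^(k - i)) with s ones; an exponent
   that is not smaller than k gives the entry 0. *)
Definition diag_exponent s i j : nat :=
  (if j < s then 0 else if j == s then i else k - i)%N.

Definition diag_jet s i : jet_index m n k -> F :=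
  fun u => ((u.1.1 == u.1.2 :> nat) && (u.2 == diag_exponent s i u.1.1 :> nat))%:R.

Lemma jet_matrix_diag s i a b :
  jet_matrix (diag_jet s i) a b =
  ((a == b :> nat) && (diag_exponent s i a < k)%N)%:R * 'X^(diag_exponent s i a).
Proof.
rewrite mxE /diag_jet /=; have [_|_] := eqVneq (a : nat) b; last first.
  by rewrite mul0r big1 // => l _; rewrite scale0r.
case: ltnP => [ek|ke]; rewrite ?mul1r ?mul0r /=.
  rewrite (bigD1 (Ordinal ek)) //= eqxx scale1r big1 ?addr0 // => l.
  by rewrite -val_eqE /= => /negPf->; rewrite scale0r.
rewrite big1 // => l _; rewrite ltn_eqF ?scale0r //.
exact: leq_trans (ltn_ord l) ke.
Qed.

(** For t = 0, 1, 2 and i at most k the sums are i, k and 2k - i, matching the leading minors of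
    sizes r - 1, r and r + 1, where r = s + 2. *)
Lemma sum_diag_exponent s i t :
  (\sum_(a < s.+1 + t) diag_exponent s i a = i + t * (k - i))%N.
Proof.
elim: t => [|t IH].
  rewrite addn0 mul0n addn0 big_ord_recr /= big1 => [|a _].
    by rewrite /diag_exponent ltnn eqxx.
  by rewrite /diag_exponent ltn_ord.
rewrite addnS big_ord_recr /= IH /diag_exponent mulSn.
by rewrite ifF ?ifF; [lia|apply/eqP; lia|apply/negP; lia].
Qed.

(** The bound on [i] enters as i <= k - i. *)
Lemma leq_diag_exponent s i : (i + i <= k)%N ->
  {homo diag_exponent s i : a b / (a <= b)%N}.
Proof.
by move=> ik a b; rewrite /diag_exponent; case: (ltngtP a s); case: (ltngtP b s); lia.
Qed.

Lemma leq_homo_ord r N (f : 'I_r -> 'I_N) :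
  {homo f : a b / (a < b)%N >-> (a < b)%N} -> forall a : 'I_r, (a <= f a)%N.
Proof.
move=> fh [a]; elim: a => [//|a IH] ar.
exact: leq_ltn_trans (IH (ltnW ar)) (fh (Ordinal (ltnW ar)) (Ordinal ar) (ltnSn a)).
Qed.

(** Each Leibniz term is divisible by t to the sum of the exponents of the chosen rows. By
    monotonicity this sum is least for the first s + 2 rows, where it equals k. *)
Lemma jetZ_diag s i : (i + i <= k)%N -> @jetZ F m n (s + 2) k (diag_jet s i).
Proof.
move=> ik f g fh gh l lk; rewrite /jet_minor /determinant coef_sum big1 // => sg _.
under eq_bigr do rewrite mxE jet_matrix_diag.
rewrite big_split /= prodrXr mulrA coefMXn ifT //.
apply: leq_trans lk _.
have {1}-> : k = (\sum_(a < s + 2) diag_exponent s i a)%N.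
  by have := sum_diag_exponent s i 1; rewrite !addn1 addn2 => ->; lia.
by apply: leq_sum => a _; apply: leq_diag_exponent (leq_homo_ord fh a).
Qed.

Lemma jet_minor_diag s i r (f : 'I_r -> 'I_m) (g : 'I_r -> 'I_n) :
  (forall a, f a = a :> nat) -> (forall a, g a = a :> nat) ->
  (forall a : 'I_r, diag_exponent s i a < k)%N ->
  jet_minor (diag_jet s i) f g = 'X^(\sum_(a < r) diag_exponent s i a).
Proof.
move=> fE gE ek; rewrite -prodrXr.
transitivity (\det (diag_mx (\row_(a < r) ('X^(diag_exponent s i a) : {poly F})))).
  congr (\det _); apply/matrixP => a b.
  by rewrite mxE jet_matrix_diag fE gE ek andbT !mxE mulr_natl.
by rewrite det_diag; apply: eq_bigr => a _; rewrite mxE.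
Qed.

Lemma diag_jet_separated s i j (S : (jet_index m n k -> F) -> Prop) :
  (s + 2 < m)%N -> (m <= n)%N -> (i < j)%N -> (j + j <= k)%N ->
  zariski_irreducible S -> Defs.subsetP S (@jetZ F m n (s + 2) k) ->
  S (diag_jet s i) -> S (diag_jet s j) -> False.
Proof.
move=> sm mn ij jk [_ _ irrS] SZ Si Sj.
have lm : (s.+1 + 2 <= m)%N by lia.
have ln : (s.+1 + 2 <= n)%N by lia.
pose f := widen_ord lm; pose g := widen_ord ln.
(* This degree, 2k - j, is the order of the larger minor at the jet of [j]; [i] is that of the
   smaller one at the jet of [i]. *)
have [p pE] := jet_minor_mpoly f g (j + 2 * (k - j)).
have [q qE] := jet_minor_mpoly (f \o lshift 2) (g \o lshift 2) i.
case: (irrS _ _ (zariski_closed_zero p) (zariski_closed_zero q)).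
- move=> x /SZ Zx; rewrite pE qE.
  by apply: (jetZ_minor_coef0 (s := s)) => //; lia.
- move=> /(_ _ Sj); rewrite pE jet_minor_diag //.
    by rewrite sum_diag_exponent coefXn eqxx => /eqP; rewrite oner_eq0.
  (* Here k - j < k because j > i >= 0. *)
  by move=> a; rewrite /diag_exponent; case: (ltngtP a s); lia.
- move=> /(_ _ Si); rewrite qE jet_minor_diag //.
    have := sum_diag_exponent s i 0; rewrite mul0n !addn0 => ->.
    by rewrite coefXn eqxx => /eqP; rewrite oner_eq0.
  (* Only the exponents 0 and [i] occur in this size, so i = 0 is harmless although then k - i =
     k. *)
  by move=> a; have := ltn_ord a; rewrite /diag_exponent; case: (ltngtP a s); lia.
Qed.

End Jets.

Theorem theorem6p1 (F : closedFieldType) (m n r k : nat) :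
  (2 <= r)%N -> (r < m)%N -> (m <= n)%N -> (1 <= k)%N ->
  exists C : 'I_(1 + k./2) -> ((jet_index m n k -> F) -> Prop),
    (forall i, irreducible_component (C i) (@jetZ F m n r k)) /\
    (forall i j, i != j -> ~ (forall x, C i x <-> C j x)).
Proof.
move=> r2 rm mn k1.
have [s rE] : exists s, r = (s + 2)%N by exists (r - 2)%N; rewrite subnK.
subst r.
have /boolp.choice[C CP] : forall i : 'I_(1 + k./2),
    exists C, irreducible_component C (@jetZ F m n (s + 2) k) /\ C (@diag_jet F m n k s i).
  move=> i; have Zi : @jetZ F m n (s + 2) k (@diag_jet F m n k s i).
    by apply: jetZ_diag; have := ltn_ord i; lia.
  by have [C] := irreducible_component_exists (@zariski_closed_jetZ F m n k (s + 2)) Zi; exists C.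
exists C; split=> [i|i j ij CE]; first by case: (CP i).
wlog lij : i j ij CE / (i < j)%N.
  move=> W; case: (ltngtP i j) => [|ji|/val_inj ijE].
  - exact: W.
  - by apply: (W j i _ _ ji) => [|x]; [rewrite eq_sym | apply: iff_sym].
  - by rewrite ijE eqxx in ij.
have [[irrC CZ _] Ci] := CP i; have [_ /CE Cj] := CP j.
by apply: (diag_jet_separated rm mn lij _ irrC CZ Ci Cj); have := ltn_ord j; lia.
Qed.
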